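(* For every simple graph with $n$ vertices (i.e. when the adjacency variables satisfy $a_{ij}\in\{0,1\}$), the parameters $\sigma_e^v$ and $h_e^v$ ($e\ge1$) are in the linear correspondence $$\sigma_e^v=\sum_{w=\omega(e)}^{v}\sum_{f=1}^{e}(-1)^{e-f+v-w}\,\frac{\sigma_{e-f}([e-1])\ \prod_{j=1}^{v-w}(n-v+j)}{e!\,(v-w)!}\,h_f^w,$$ where $\omega(x)=\left\lceil\tfrac12+\tfrac{\sqrt{1+8x}}{2}\right\rceil$ and $\sigma_a([b])=\sigma_a(1,2,\ldots,b)$ with $\sigma_a$ the classical elementary symmetric polynomial of degree $a$.
   Context: Graphs are finite and simple. For a graph $\mathcal{G}$ with $n$ vertices, $$\sigma_e^v(\mathcal{G})=\sum_{A\subseteq\mathcal{G},\,cv(A)=v,\,|A|=e}I(A)(\mathcal{G}),$$ where the sum is over unlabeled subgraphs $A$ (without isolated vertices), $I(A)(\mathcal{G})$ is the number of (not necessarily induced) subgraphs of $\mathcal{G}$ isomorphic to $A$, $cv(A)$ is the number of vertices connected to edges of $A$ and $|A|$ is the number of edges of $A$. Further $$h_e^v(\mathcal{G})=\sum_{A\subseteq\mathcal{G},\,v(A)=v}|A|^e,$$ where the sum is over all $v$-vertex subsets of $\mathcal{G}$ and $A$ is the subgraph of $\mathcal{G}$ induced on the subset. $\sigma_0([b])=1$ and $\sigma_a([b])=0$ for $a>b$. *)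

(* Defs.v *)
From mathcomp Require Import all_boot all_order all_algebra.
From mathcomp Require Import reals.
From mathcomp Require mpoly.

Set Implicit Arguments.
Unset Strict Implicit.
Unset Printing Implicit Defensive.

Import Order.TTheory GRing.Theory Num.Theory.

Record sgraph := SGraph {
  vertex :> finType;
  adj : rel vertex;
  adj_sym : symmetric adj;
  adj_irr : irreflexive adj }.

Section Graph.
Variable G : sgraph.

Definition edges : {set {set G}} :=
  [set [set p.1; p.2] | p : G * G & adj p.1 p.2].

(* A subgraph without isolated vertices is determined by its edge set
   A \subset edges; its vertex set is then [cover A]. *)
Definition cv (A : {set {set G}}) : nat := #|cover A|.

(* Isomorphism of the graphs (cover A, A) and (cover B, B).  The values of f
   outside cover A are irrelevant, and f @: cover A = cover B is automatic. *)
Definition iso : rel {set {set G}} := fun A B =>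
  [exists f : {ffun G -> G},
     dinjectiveb f (cover A) && (B == [set f @: E | E : {set G} in A])].

Lemma iso_equiv (D : {set {set {set G}}}) :
  {in D & &, equivalence_rel iso}.
Proof.
have comp (f g : {ffun G -> G}) (A : {set {set G}}) :
    [set [ffun x => g (f x)] @: E | E : {set G} in A] =
    [set g @: E | E : {set G} in [set f @: E | E : {set G} in A]].
  rewrite -imset_comp; apply: eq_imset => E /=; rewrite -imset_comp.
  by apply: eq_imset => x; rewrite ffunE.
have covI (f : {ffun G -> G}) (A : {set {set G}}) x :
    x \in cover A -> f x \in cover [set f @: E | E : {set G} in A].
  case/bigcupP=> E EA xE; apply/bigcupP.
  by exists (f @: E); [exact: imset_f | exact: imset_f].
have iso_refl A : iso A A.
  apply/existsP; exists [ffun x => x]; apply/andP; split.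
    by apply/dinjectiveP => x y _ _; rewrite !ffunE.
  apply/eqP; rewrite -[LHS]imset_id; apply: eq_imset => E.
  by rewrite -[LHS]imset_id; apply: eq_imset => x; rewrite ffunE.
have iso_trans A B C : iso A B -> iso B C -> iso A C.
  case/existsP=> f /andP[/dinjectiveP fi /eqP ->].
  case/existsP=> g /andP[/dinjectiveP gi /eqP ->].
  apply/existsP; exists [ffun x => g (f x)]; rewrite comp eqxx andbT.
  apply/dinjectiveP => x y xA yA; rewrite !ffunE => /gi eqf.
  by apply: fi => //; apply: eqf; apply: covI.
have iso_symm A B : iso A B -> iso B A.
  case/existsP=> f /andP[/dinjectiveP fi /eqP ->].
  pose g := [ffun y => odflt y [pick x in cover A | f x == y]].
  have gK : {in cover A, forall x, g (f x) = x}.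
    move=> x xA; rewrite ffunE; case: pickP => [z /andP[zA /eqP]|/(_ x)] /=.
      exact: fi.
    by rewrite xA eqxx.
  have sub E x : E \in A -> x \in E -> x \in cover A.
    by move=> EA xE; apply/bigcupP; exists E.
  apply/existsP; exists g; apply/andP; split.
    apply/dinjectiveP => x y /bigcupP[_ /imsetP[E EA ->] /imsetP[x' xE ->]].
    move=> /bigcupP[_ /imsetP[F FA ->] /imsetP[y' yF ->]].
    by rewrite !gK ?(sub _ _ EA xE) ?(sub _ _ FA yF) // => ->.
  apply/eqP; rewrite -imset_comp -[LHS]imset_id; apply: eq_in_imset => E EA /=.
  rewrite -imset_comp -[LHS]imset_id; apply: eq_in_imset => x xE /=.
  by rewrite gK // (sub E).
move=> A B C _ _ _; split=> // AB.
by apply/idP/idP; apply: iso_trans => //; apply: iso_symm.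
Qed.

(* Subgraphs without isolated vertices, up to isomorphism: one representative
   of each isomorphism class. *)
Definition unlabeled_subgraphs : {set {set {set G}}} :=
  transversal (equivalence_partition iso (powerset edges)) (powerset edges).

Definition ncopies (A : {set {set G}}) : nat :=
  #|[set B in powerset edges | iso A B]|.

Definition sigma (e v : nat) : nat :=
  \sum_(A in unlabeled_subgraphs | (cv A == v) && (#|A| == e)) ncopies A.

Definition induced_edges (S : {set G}) : {set {set G}} :=
  [set E in edges | E \subset S].

Definition h (e v : nat) : nat :=
  \sum_(S : {set G} | #|S| == v) #|induced_edges S| ^ e.

End Graph.

Local Open Scope ring_scope.

(* The ceiling is an integer, at least 1, so taking its absolute value only
   changes its type. *)
Definition omega (R : realType) (x : nat) : nat :=
  `|Num.ceil (1 / 2 + Num.sqrt (1 + 8 * x%:R) / 2 : R)|%N.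

(* sigma_a([b]) = sigma_a(1, 2, ..., b), with 'I_b ranging over 0, ..., b-1. *)
Definition elem_sym (R : realType) (a b : nat) : R :=
  mpoly.meval (fun i : 'I_b => i.+1%:R) (mpoly.mesym b R a).

(* Main.v *)
(* Let c(S) = C(m(S), e) count the e-edge subgraphs inside a vertex set S that
   spans m(S) edges, and let g(w) be the sum of c(S) over the w-subsets S.  An
   e-edge subgraph covering u vertices lies in C(n-u, w-u) of these S, and this
   relation is inverted by
     sigma_e^v = sum_w (-1)^(v-w) C(n-w, v-w) g(w).
   Expanding m(m-1)...(m-e+1) in powers of m, with coefficients elementary
   symmetric in 1, ..., e-1, turns e! g(w) into a combination of the h_f^w.  The
   terms with w < omega(e) vanish since w vertices span at most C(w,2) < e
   edges. *)

Require Import Defs.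
From mathcomp Require Import all_boot all_order all_algebra.
From mathcomp Require Import reals.
From mathcomp Require Import zify ring lra.
From mathcomp Require mpoly.

Import Order.TTheory GRing.Theory Num.Theory.
Local Open Scope ring_scope.

Lemma ffactnD n a b : (n ^_ (a + b) = n ^_ a * (n - a) ^_ b)%N.
Proof.
elim: b => [|b IHb]; first by rewrite addn0 ffactn0 muln1.
by rewrite addnS !ffactnSr IHb -mulnA subnDA.
Qed.

(** Multiplied by [k! (d-k)!], both sides become the falling factorial [n ^_ d]. *)
Lemma mul_bin_bin n d k : (k <= d)%N ->
  ('C(n, k) * 'C(n - k, d - k) = 'C(n, d) * 'C(d, k))%N.
Proof.
move=> le_kd; apply/eqP.
rewrite -(@eqn_pmul2r (k`! * (d - k)`!)) ?muln_gt0 ?fact_gt0 //; apply/eqP.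
rewrite mulnACA !bin_ffact -ffactnD subnKC //.
by rewrite -mulnA bin_fact // bin_ffact.
Qed.

Lemma natr_ffact (R : pzRingType) m k :
  (m ^_ k)%:R = \prod_(i < k) (m%:R - i%:R) :> R.
Proof.
elim: k => [|k IHk]; first by rewrite big_ord0.
rewrite ffactnSr big_ord_recr /= -IHk natrM.
(* For [m < k] the natural subtraction [m - k] truncates, but [m ^_ k] is already zero. *)
have [le_km | lt_mk] := leqP k m; first by rewrite natrB.
by rewrite ffact_small // !mul0r.
Qed.

(** Adjoining [U] is a bijection from the subsets of its complement to its supersets. The [if]
    guards against [w < #|U|], where the truncated [w - #|U|] would give a binomial equal to 1. *)
Lemma card_supersets (T : finType) (U : {set T}) (w : nat) :
  #|[set S : {set T} | U \subset S & #|S| == w]| =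
  if (#|U| <= w)%N then 'C(#|T| - #|U|, w - #|U|) else 0%N.
Proof.
case: leqP => [leUw | ltwU]; last first.
  apply: eq_card0 => S; rewrite !inE; apply/negP => /andP[/subset_leq_card].
  by move=> leUS /eqP eqw; rewrite eqw leqNgt ltwU in leUS.
rewrite -(cardsC U) addKn -cards_draws.
rewrite -[RHS](@card_in_imset _ _ (fun W : {set T} => U :|: W)); last first.
  move=> W W'; rewrite !inE => /andP[sW _] /andP[sW' _] eqUW.
  have delta (V : {set T}) : V \subset ~: U -> (U :|: V) :\: U = V.
    move=> sV; rewrite setDUl setDv set0U.
    by apply/setDidPl; rewrite disjoints_subset.
  by rewrite -(delta W) // eqUW delta.
apply: eq_card => S; rewrite !inE; apply/idP/imsetP.
  case/andP=> sUS /eqP cS; exists (S :\: U).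
    by rewrite inE setDE subsetIr -setDE cardsD (setIidPr sUS) cS eqxx.
  by rewrite setUC setDE setUIl setUC (setUidPr sUS) setUC setUCr setIT.
case=> W; rewrite inE => /andP[sW /eqP cW] ->; rewrite subsetUl /=.
rewrite cardsU cW (_ : U :&: W = set0) ?cards0 ?subn0 ?subnKC //.
by apply/eqP; rewrite setI_eq0 disjoint_sym disjoints_subset.
Qed.

(** With [N = #|T|], [u = #|U|] and [w = u + k], [mul_bin_bin] turns the product of binomials into
    [C(N-u, v-u) C(v-u, k)]. What remains is the expansion of [(-1 + 1)^(v-u)]. *)
Lemma sum_signed_supersets (R : comPzRingType) (T : finType) (U : {set T}) v :
  \sum_(0 <= w < v.+1) (-1) ^+ (v - w) * 'C(#|T| - w, v - w)%:R *
     #|[set S : {set T} | U \subset S & #|S| == w]|%:R =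
  (#|U| == v)%:R :> R.
Proof.
pose u := #|U|; have [lt_vu | le_uv] := ltnP v u.
  rewrite gtn_eqF // big_nat big1 // => w /andP[_ lt_wv].
  by rewrite card_supersets leqNgt (leq_trans lt_wv) ?mulr0.
rewrite (big_cat_nat _ (n := u)) ?leqW //= big_nat big1 ?add0r; last first.
  by move=> w /andP[_ lt_wu]; rewrite card_supersets leqNgt lt_wu mulr0.
rewrite -{1}[u]add0n big_addn subSn // big_mkord.
transitivity (\sum_(k < (v - u).+1)
    (-1) ^+ (v - u - k) * 1 ^+ k *+ 'C(v - u, k) *
    'C(#|T| - u, v - u)%:R : R).
  apply: eq_bigr => k _; rewrite card_supersets leq_addl addnK.
  rewrite expr1n mulr1 -[in RHS]mulr_natr -!mulrA -!natrM -/u (addnC k) !subnDA.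
  congr (_ * _%:R).
  by rewrite mulnC [RHS]mulnC -mul_bin_bin // -ltnS.
rewrite -mulr_suml -exprDn addNr expr0n subn_eq0.
case: ltngtP le_uv => // [lt_uv _|-> _]; first by rewrite mul0r.
by rewrite subnn bin0 mulr1.
Qed.

Section Graph.
Variable G : sgraph.
Implicit Types (A B : {set {set G}}) (S : {set G}).

(** Edges of [A] are subsets of [cover A], where [f] is injective, so distinct edges have distinct
    images. *)
Lemma iso_invariant A B : iso A B -> (cv A = cv B) * (#|A| = #|B|).
Proof.
case/existsP=> f /andP[/dinjectiveP fi /eqP ->]; split.
  rewrite /cv -(card_in_imset fi); apply: eq_card => y.
  apply/imsetP/bigcupP => [[x /bigcupP[E EA xE] ->] | [_ /imsetP[E EA ->]]].
    by exists (f @: E); apply: imset_f.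
  by case/imsetP=> x xE ->; exists x => //; apply/bigcupP; exists E.
rewrite card_in_imset // => E F EA FA eqf.
have sub D x : D \in A -> x \in D -> x \in cover A.
  by move=> DA xD; apply/bigcupP; exists D.
have half D D' : D \in A -> D' \in A -> f @: D = f @: D' -> D \subset D'.
  move=> DA D'A eqD; apply/subsetP => x xD.
  have : f x \in f @: D' by rewrite -eqD imset_f.
  by case/imsetP=> y yD' /fi -> //; [exact: sub DA xD | exact: sub D'A yD'].
by apply/eqP; rewrite eqEsubset !half.
Qed.

(** Class sizes summed over representatives count each edge set once, and [cv] and the number of
    edges are constant on a class. *)
Lemma sigmaE e v :
  sigma G e v = #|[set B in powerset (edges G) | (cv B == v) && (#|B| == e)]|.
Proof.
set D := powerset (edges G).
have eqv := @iso_equiv G D.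
set P := equivalence_partition (@iso G) D.
have trX := transversalP (equivalence_partitionP eqv : partition P D).
rewrite /sigma /unlabeled_subgraphs -/D -/P.
set X := transversal P D in trX *; have sXD := subsetP (transversal_sub trX).
under eq_bigr => A _ do rewrite /ncopies -sum1_card.
rewrite (exchange_big_dep (mem [set B in D | (cv B == v) && (#|B| == e)])) /=.
  rewrite -sum1_card; apply: eq_bigr => B.
  rewrite !inE => /andP[sBE /andP[cvB cB]].
  have BD : B \in D by rewrite powersetE.
  have iso_pblock A : A \in X -> iso A B = (pblock P A == pblock P B).
    move=> /sXD AD; rewrite -(pblock_equivalence_partition eqv) // -/P.
    have /and3P[/and3P[/eqP covP tiP _] _ _] := trX.
    by rewrite eq_pblock ?covP.
  have : pblock P B \in pblock P @: X.
    rewrite (pblock_transversal trX) pblock_mem //.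
    by have /and3P[/and3P[/eqP -> _ _] _ _] := trX.
  (* [A] is the one representative in the block of [B], so the inner sum has a single term. *)
  case/imsetP=> A AX eqBA; rewrite (big_pred1 A) // => A' /=.
  rewrite !inE -(andbA (A' \in X)); apply/idP/eqP.
    case/and3P=> A'X _ /andP[_]; rewrite iso_pblock // eqBA => /eqP.
    exact: (pblock_inj trX).
  move=> ->; have isoAB : iso A B by rewrite iso_pblock // eqBA.
  have [-> ->] := iso_invariant A B isoAB.
  by rewrite AX cvB cB isoAB sBE.
move=> A B /andP[AX /andP[cvA cA]]; rewrite !inE => /andP[BD isoAB].
by have [<- <-] := iso_invariant A B isoAB; rewrite BD cvA cA.
Qed.

(** Double counting of pairs [(B, S)]: the edges of [B] all lie in [S] exactly when [cover B]
    does. *)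
Lemma sum_bin_induced_edges (e w : nat) :
  (\sum_(S : {set G} | #|S| == w) 'C(#|induced_edges S|, e) =
   \sum_(B in powerset (edges G) | #|B| == e)
      #|[set S : {set G} | cover B \subset S & #|S| == w]|)%N.
Proof.
under [LHS]eq_bigr => S _ do rewrite -cards_draws -sum1_card.
under [RHS]eq_bigr => B _ do rewrite -sum1_card.
rewrite (exchange_big_dep
  (fun B => (B \in powerset (edges G)) && (#|B| == e))) /=.
  apply: eq_bigr => B; rewrite inE => /andP[BE cB]; apply: eq_bigl => S.
  rewrite !inE cB andbT andbC; congr andb; apply/subsetP/bigcupsP => sub E EB.
    by have := sub E EB; rewrite inE => /andP[].
  by rewrite inE sub // (subsetP BE).
move=> S B _; rewrite !inE => /andP[sB ->]; rewrite andbT.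
by apply: subset_trans sB _; apply/subsetP => E; rewrite inE => /andP[].
Qed.

Lemma card_induced_edges S : (#|induced_edges S| <= 'C(#|S|, 2))%N.
Proof.
rewrite -cards_draws; apply: subset_leq_card; apply/subsetP => E.
rewrite !inE => /andP[/imsetP[[x y] /= xy ->] ->] /=.
by rewrite cards2; case: (eqVneq x y) xy => // <-; rewrite inE /= adj_irr.
Qed.

(** After exchanging sums, each [B] carries the signed count of supersets of [cover B], which
    collapses to the indicator of [cv B = v]. *)
Lemma sigma_inversion (R : comPzRingType) e v :
  (sigma G e v)%:R =
  \sum_(0 <= w < v.+1) (-1) ^+ (v - w) * 'C(#|G| - w, v - w)%:R *
    (\sum_(S : {set G} | #|S| == w) 'C(#|induced_edges S|, e))%:R :> R.
Proof.
under eq_bigr => w _ do rewrite sum_bin_induced_edges natr_sum mulr_sumr.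
rewrite exchange_big /=.
under eq_bigr => B _ do rewrite sum_signed_supersets.
rewrite sigmaE -sum1_card natr_sum [LHS]big_mkcond [RHS]big_mkcond /=.
apply: eq_bigr => B _; rewrite !inE -/(cv B).
by case: (B \subset _); case: (_ == v); case: (_ == e).
Qed.

End Graph.

(** Vieta's formulas for the polynomial with roots [1, ..., e-1]; the remaining factor [m] of
    [m ^_ e] shifts the powers to start at 1. *)
Lemma sum_elem_sym (R : realType) e m : (0 < e)%N ->
  \sum_(1 <= f < e.+1) (-1) ^+ (e - f) * elem_sym R (e - f) (e - 1) * m%:R ^+ f
  = (m ^_ e)%:R :> R.
Proof.
case: e => // k _; rewrite big_add1 /= subn1 /=.
pose cs := [tuple (i.+1)%:R : R | i < k].
pose P := \prod_(c <- cs) ('X - c%:P).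
have szP : size P = k.+1 by rewrite size_prod_XsubC size_tuple.
have PE : P.[m%:R] = \prod_(i < k) (m%:R - i.+1%:R).
  rewrite /P big_tuple horner_prod; apply: eq_bigr => i _.
  by rewrite tnth_mktuple hornerXsubC.
rewrite natr_ffact big_ord_recl subr0 -PE horner_coef szP big_mkord mulr_sumr.
apply: eq_bigr => i _; rewrite subSS exprSr mulrA [RHS]mulrC.
congr (_ * _ * _).
have le_ik : (i <= k)%N by rewrite -ltnS.
(* Vieta's formula indexes coefficients from the top, so that of ['X^i] is reached at index
   [k - i]. *)
have := mpoly.mroots_coeff cs (inord (k - i)).
rewrite inordK ?ltnS ?leq_subr // subKn // -/P => ->; congr (_ * _).
by rewrite /elem_sym; apply: mpoly.meval_eq => j; rewrite tnth_mktuple.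
Qed.

Lemma sum_elem_sym_h (R : realType) (G : sgraph) e w : (0 < e)%N ->
  \sum_(1 <= f < e.+1)
     (-1) ^+ (e - f) * elem_sym R (e - f) (e - 1) * (h G f w)%:R
  = e`!%:R * (\sum_(S : {set G} | #|S| == w) 'C(#|induced_edges S|, e))%:R.
Proof.
move=> e_gt0; rewrite natr_sum mulr_sumr.
under eq_bigr => f _ do rewrite /h natr_sum mulr_sumr.
rewrite exchange_big /=; apply: eq_bigr => S _.
under eq_bigr => f _ do rewrite natrX.
by rewrite sum_elem_sym // -natrM mulnC bin_ffact.
Qed.

(** The product is the falling factorial [(n-w) ^_ (v-w)] read backwards, from [n-v+1] up to
    [n-w]. *)
Lemma bin_prod (R : numFieldType) n v w : (w <= n)%N -> (w <= v)%N ->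
  'C(n - w, v - w)%:R =
  (\prod_(1 <= j < (v - w).+1) (n%:R - v%:R + j%:R)) / (v - w)`!%:R :> R.
Proof.
move=> le_wn le_wv.
have nz : (v - w)`!%:R != 0 :> R by rewrite pnatr_eq0 -lt0n fact_gt0.
apply: (canRL (mulfK nz)); rewrite -natrM bin_ffact natr_ffact.
rewrite big_add1 /= big_mkord (reindex_inj rev_ord_inj) /=.
apply: eq_bigr => i _; by rewrite !natrB //; ring.
Qed.

(** Put [s = sqrt (1 + 8e)]. For [w = k+1] the bound below the ceiling says [2k+1 < s]; squaring
    gives [4k(k+1) < 8e]. *)
Lemma bin2_lt_omega (R : realType) e w :
  (0 < e)%N -> (w < omega R e)%N -> ('C(w, 2) < e)%N.
Proof.
case: w => [|k] // _.
have r_ge0 : 0 <= 1 + 8 * e%:R :> R by rewrite addr_ge0 ?mulr_ge0 ?ler0n.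
have s_ge0 := sqrtr_ge0 (1 + 8 * e%:R : R); have := sqr_sqrtr r_ge0.
rewrite /omega; set s : R := Num.sqrt _ in s_ge0 *; move=> s2.
have c_ge0 : 0 <= Num.ceil (1 / 2 + s / 2) by rewrite ceil_ge0; lra.
rewrite -ltz_nat gez0_abs // ceil_gt_int -pmulrn => lt_ks.
have k_ge0 : 0 <= k%:R :> R by [].
have lt_s : 2 * k%:R + 1 < s by move: lt_ks; rewrite -(natr1 k); lra.
have : 4 * (k.+1 * k)%N%:R < 8 * e%:R :> R.
  by rewrite natrM -(natr1 k); nra.
by rewrite -!natrM ltr_nat bin2 /=; lia.
Qed.

Theorem theorem5 (R : realType) (G : sgraph) (n e v : nat)
    (hn : #|G| = n) (he : (1 <= e)%N) :
  (sigma G e v)%:R =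
    \sum_(omega R e <= w < v.+1) \sum_(1 <= f < e.+1)
      (-1) ^+ ((e - f) + (v - w)) *
      ((elem_sym R (e - f) (e - 1) *
          \prod_(1 <= j < (v - w).+1) (n%:R - v%:R + j%:R))
        / (e`!%:R * (v - w)`!%:R)) * (h G f w)%:R :> R.
Proof.
rewrite sigma_inversion [RHS](big_nat_widenl _ _ _ _ _ (leq0n _)).
rewrite [RHS]big_mkcond; apply: eq_big_nat => w /andP[_ lt_wv].
have le_wv : (w <= v)%N by rewrite -ltnS.
have e_nz : e`!%:R != 0 :> R by rewrite pnatr_eq0 -lt0n fact_gt0.
(* Either there is no [w]-subset at all, or each one spans fewer than [e] edges. *)
have small : (#|G| < w)%N || (w < omega R e)%N ->
    (\sum_(S : {set G} | #|S| == w) 'C(#|induced_edges S|, e) = 0)%N.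
  move=> cond; apply: big1 => S /eqP cS; apply: bin_small.
  case/orP: cond => [|lt_w_omega]; first by rewrite -cS ltnNge max_card.
  apply: leq_ltn_trans (card_induced_edges G S) _.
  by rewrite cS (bin2_lt_omega R).
case: leqP => /= [le_omega_w | lt_w_omega]; last first.
  by rewrite small ?lt_w_omega ?orbT ?mulr0.
(* The part of the summand that does not depend on [f]. *)
pose c := (-1) ^+ (v - w) *
   ((\prod_(1 <= j < (v - w).+1) (n%:R - v%:R + j%:R)) / (v - w)`!%:R) /
   e`!%:R : R.
rewrite (eq_bigr (fun f => c *
   ((-1) ^+ (e - f) * elem_sym R (e - f) (e - 1) * (h G f w)%:R))); last first.
  by move=> f _; rewrite /c exprD invfM; ring.
rewrite -mulr_sumr sum_elem_sym_h // mulrA /c divfK //.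
(* For [w > n] the binomial with truncated [n - w] and the product may differ, but both multiply an
   empty sum. *)
have [le_wn | lt_nw] := leqP w n; first by rewrite hn -bin_prod.
by rewrite small ?hn ?lt_nw // !mulr0.
Qed.
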